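(* Let $\alpha$ be a peak composition. (a) As multisets, $\{\mathrm{Des}(\mathrm{w}_{\rm c}(T))\mid T\in\mathrm{SPIT}(\alpha)\}=\{\mathrm{Des}(\mathrm{w}_{\rm r}(T))\mid T\in\mathrm{SPIT}(\alpha)\}$. (b) The quasisymmetric Schur $Q$-function satisfies $$\widetilde{Q}_\alpha=\sum_{T\in\mathrm{SPIT}(\alpha)}K_{\mathrm{comp}(\mathrm{Peak}(\mathrm{Des}(\mathrm{w}_{\rm r}(T))))}.$$
   Context: A composition $\alpha=(\alpha_1,\dots,\alpha_k)$ of $n$ is a finite list of positive integers with sum $n$; $\ell(\alpha)=k$. Its diagram $D(\alpha)$ is the left-justified array with $\alpha_i$ boxes in row $i$, rows numbered from bottom to top. A peak composition is a composition all of whose parts, except possibly the last, are greater than $1$. A standard immaculate tableau (SIT) of shape $\alpha$ is a filling of $D(\alpha)$ with the numbers $1,\dots,n$, each used once, whose rows increase from left to right and whose first column increases from bottom to top. For a peak composition $\alpha$ of $n$, a standard peak immaculate tableau (SPIT) of shape $\alpha$ is an SIT of shape $\alpha$ such that for every $1\le k\le n$ the boxes with entries $\le k$ form the diagram of a peak composition; $\mathrm{SPIT}(\alpha)$ is the set of these. Column reading $\mathrm{w}_{\rm c}(T)$: read entries column by column starting from the leftmost column, each column from bottom to top. Row reading $\mathrm{w}_{\rm r}(T)$: read entries row by row starting from the uppermost row, each row from left to right. Both are regarded as permutations in one-line notation. For a permutation $\sigma$ of $[n]$, $\mathrm{Des}(\sigma)=\{i\in[n-1]\mid i$ is to the right of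 $i+1$ in $\sigma(1)\cdots\sigma(n)\}$. For a finite set $X$ of positive integers, $\mathrm{Peak}(X)=\{i\in X\mid i>1,\ i-1\notin X\}$. For a composition $\gamma$ of $n$, $\mathrm{set}(\gamma)=\{\gamma_1,\gamma_1+\gamma_2,\dots,\gamma_1+\cdots+\gamma_{\ell(\gamma)-1}\}$; for $I=\{i_1<\cdots<i_p\}\subseteq[n-1]$, $\mathrm{comp}(I)=(i_1,i_2-i_1,\dots,n-i_p)$. The fundamental quasisymmetric function is $F_\gamma=\sum x_{i_1}\cdots x_{i_n}$ over $1\le i_1\le\cdots\le i_n$ with $i_j<i_{j+1}$ whenever $j\in\mathrm{set}(\gamma)$. For a peak composition $\gamma$ of $n$ with $I=\mathrm{set}(\gamma)$, the peak quasisymmetric function is $K_\gamma=2^{|I|+1}\sum F_\beta$, summed over compositions $\beta$ of $n$ with $I\subseteq \mathrm{set}(\beta)\,\triangle\,(\mathrm{set}(\beta)+1)$, where $\triangle$ is symmetric difference and $\mathrm{set}(\beta)+1=\{i+1\mid i\in\mathrm{set}(\beta)\}$. The quasisymmetric Schur $Q$-function is defined by $\widetilde{Q}_\alpha=\sum_{T\in\mathrm{SPIT}(\alpha)}K_{\mathrm{comp}(\mathrm{Peak}(\mathrm{Des}(\mathrm{w}_{\rm c}(T))))}$. *)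

(* Defs.v *)
From mathcomp Require Import all_boot all_order all_algebra.
From mathcomp Require Import finmap functions.
From mathcomp.multinomials Require Import monalg.

Set Implicit Arguments.
Unset Strict Implicit.
Unset Printing Implicit Defensive.

Import GRing.Theory.

Local Open Scope nat_scope.
Local Open Scope fset_scope.

(** * Compositions *)

Definition is_comp (n : nat) (b : seq nat) : bool :=
  all (leq 1) b && (sumn b == n).

(* A composition of n has at most n parts, each of them at most n. *)
Definition comps (n : nat) : seq (seq nat) :=
  [seq b <- [seq map val b | b : n.-bseq 'I_n.+1] | is_comp n b].

Lemma mem_comps n b : (b \in comps n) = is_comp n b.
Proof.
rewrite mem_filter; case: (boolP (is_comp n b)) => //= /andP[b_gt0 /eqP sum_b].
have size_b : size b <= n.
  rewrite -sum_b; elim: b b_gt0 {sum_b} => //= x b IH /andP[x_gt0 /IH].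
  by move=> ?; rewrite -addn1 addnC leq_add.
have b_le : all (fun x => x < n.+1) b.
  apply/allP=> x /(nthP 0)[i lt_i <-]; rewrite ltnS -sum_b.
  by rewrite sumnE (big_nth 0) big_mkord (bigD1 (Ordinal lt_i)) //= leq_addr.
have size_c : size [seq (inord x : 'I_n.+1) | x <- b] <= n by rewrite size_map.
apply/mapP; exists (Bseq size_c); first by rewrite mem_enum.
rewrite /= -map_comp -[LHS]map_id; apply/eq_in_map => x x_b /=.
by rewrite inordK //; exact: (allP b_le).
Qed.

Lemma comps_uniq n : uniq (comps n).
Proof.
rewrite filter_uniq // map_inj_uniq ?enum_uniq // => b c /inj_map eq_bc.
exact/val_inj/eq_bc/val_inj.
Qed.

Definition peak_comp (a : seq nat) : bool :=
  all (leq 1) a && all (leq 2) (take (size a).-1 a).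

Definition set_of_comp (a : seq nat) : {fset nat} :=
  [fset sumn (take k a) | k in iota 1 (size a).-1].

(* Meant for I a subset of [n-1]. *)
Definition comp_of_set (n : nat) (I : {fset nat}) : seq nat :=
  if n == 0 then [::]
  else pairmap (fun a b => b - a) 0 (rcons (sort leq I) n).

(** * Tableaux *)

(* Box (i, j) lies in row i (from the bottom) and column j, counted from 0. *)
Definition boxes (a : seq nat) : seq (nat * nat) :=
  [seq (i, j) | i <- iota 0 (size a), j <- iota 0 (nth 0 a i)].

Definition diagram (a : seq nat) : {fset nat * nat} := [fset b in boxes a].

(* A filling is the list of its rows, from bottom to top, each row being read
   from left to right. *)
Definition entry (T : seq (seq nat)) (b : nat * nat) : nat :=
  nth 0 (nth [::] T b.1) b.2.

Definition fillings (a : seq nat) : seq (seq (seq nat)) :=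
  [seq reshape a w | w <- permutations (iota 1 (sumn a))].

Lemma mem_fillings a T :
  (T \in fillings a) =
  (shape T == a) && perm_eq (flatten T) (iota 1 (sumn a)).
Proof.
apply/mapP/andP => [[w]|[/eqP <- perm_T]]; last first.
  by exists (flatten T); rewrite ?flattenK // mem_permutations.
rewrite mem_permutations => perm_w ->.
have size_w : size w = sumn a by rewrite (perm_size perm_w) size_iota.
by rewrite reshapeKl ?size_w // reshapeKr ?size_w.
Qed.

Lemma fillings_uniq a : uniq (fillings a).
Proof.
rewrite map_inj_in_uniq ?permutations_uniq // => v w.
rewrite !mem_permutations => /perm_size + /perm_size.
rewrite size_iota => size_v size_w /(congr1 flatten).
by rewrite !reshapeKr ?size_v ?size_w.
Qed.

Definition SIT (a : seq nat) : seq (seq (seq nat)) :=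
  [seq T <- fillings a |
     all (sorted ltn) T && sorted ltn [seq head 0 r | r <- T]].

Definition boxes_le (k : nat) (T : seq (seq nat)) : {fset nat * nat} :=
  [fset b in diagram (shape T) | entry T b <= k].

(* If T contains 1, ..., k once each, boxes_le k T has k elements, so only
   compositions of k need to be considered. *)
Definition SPIT (a : seq nat) : seq (seq (seq nat)) :=
  [seq T <- SIT a |
     all (fun k => has (fun b => peak_comp b && (boxes_le k T == diagram b))
                       (comps k))
         (iota 1 (sumn a))].

Definition wc (T : seq (seq nat)) : seq nat :=
  flatten [seq [seq nth 0 r j | r <- T & j < size r]
             | j <- iota 0 (\max_(r <- T) size r)].

Definition wr (T : seq (seq nat)) : seq nat := flatten (rev T).

(** * Descents and peaks *)

(* Here s is a permutation of 1, ..., size s in one-line notation. *)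
Definition Des (s : seq nat) : {fset nat} :=
  [fset i in iota 1 (size s).-1 | index i.+1 s < index i s].

Definition Peak (X : {fset nat}) : {fset nat} :=
  [fset i in X | (1 < i) && (i.-1 \notin X)].

(** * Quasisymmetric functions *)

Local Open Scope ring_scope.

(* Formal power series with integer coefficients in x_1, x_2, ...; a monomial
   is an element of the free commutative monoid on nat (x_0 is never used), and
   the additive structure is the pointwise one on functions. *)
Definition fps : zmodType := {cmonom nat} -> int.

(* The index sequences (i_1, ..., i_n) in the definition of F. *)
Definition F_index (g : seq nat) (i : seq nat) : bool :=
  [&& size i == sumn g, all (leq 1) i, sorted leq i
    & all (fun j => nth 0 i j.-1 < nth 0 i j)%N (set_of_comp g)].

(* The coefficient of m in F is the number of index sequences with monomial m;
   such sequences only involve variables occurring in m. *)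
Definition F (g : seq nat) : fps := fun m : {cmonom nat} =>
  (#|[set t : (sumn g).-tuple (finsupp m) |
       F_index g (map val t)
       && (\big[mmul/mone]_(k <- map val t) ucm k == m)]|)%:Z.

(* S symmetric-difference (S + 1) *)
Definition symdiff_succ (S : {fset nat}) : {fset nat} :=
  let S1 := [fset i.+1 | i in S] in (S `\` S1) `|` (S1 `\` S).

Definition K (g : seq nat) : fps :=
  (\sum_(b <- comps (sumn g) |
          set_of_comp g `<=` symdiff_succ (set_of_comp b)) F b)
    *+ 2 ^ (#|` set_of_comp g|).+1.

(* Quasisymmetric Schur Q-function *)
Definition Qtilde (a : seq nat) : fps :=
  \sum_(T <- SPIT a) K (comp_of_set (sumn a) (Peak (Des (wc T)))).

(* Main.v *)
Require Import Defs.
From mathcomp Require Import all_boot all_order all_algebra.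
From mathcomp Require Import finmap functions zify.

(** SPITs of shape [alpha] are the linear extensions of the poset on the boxes
    with covers (i, j) < (i, j+1) and (i, 1) < (i+1, 0), because the entries at
    most k fill a peak composition diagram for every k exactly when row i has
    two filled boxes before row i+1 is started.  Descents of the column and of
    the row reading are descents of a linear extension for two labelings of the
    boxes, by position in the reading, and both labelings increase along the
    first kind of cover and decrease along the second.  As in Stanley's theory
    of (P, w)-partitions, the multiset of descent sets depends only on this:
    linear extensions with descents inside S are sequences of blocks, each
    sorted by label, and re-sorting the blocks by the other label is a bijection;
    the counts for all S determine the multiset by inclusion-exclusion. *)

Set Implicit Arguments.
Unset Strict Implicit.
Unset Printing Implicit Defensive.

Local Open Scope fset_scope.
Local Open Scope nat_scope.

(** * Recovering a multiset of finite sets from subset counts *)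

(** Strong induction on the cardinality of [S]: the sets contained in [S] are the copies of [S] and
    its proper subsets, whose multiplicities already agree. *)
Lemma count_fsubset_perm (X Y : seq {fset nat}) :
  (forall S : {fset nat}, count (fun A => A `<=` S) X = count (fun A => A `<=` S) Y) ->
  perm_eq X Y.
Proof.
move=> eqXY; apply/permP => P.
suff {P} eq_mem S : count_mem S X = count_mem S Y.
  by apply/permP/allP => S _; rewrite /= eq_mem.
have [m] := ubnP #|` S|; elim: m S => // m IH S lt_S.
have split_count Z : count (fun A => A `<=` S) Z =
    count_mem S Z + \sum_(A <- enum_fset (fpowerset S) | A != S) count_mem A Z.
  elim: Z => [|B Z /= ->]; first by rewrite big1.
  rewrite big_split /= addnACA; congr (_ + _).
  have [-> | neq] := eqVneq B S.
    by rewrite fsubset_refl big1 // => A /negPf; rewrite eq_sym => ->.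
  have [sub|nsub] := boolP (B `<=` S).
    rewrite (big_rem B) /=; last by rewrite fpowersetE.
    rewrite neq eqxx big_seq_cond big1 // => A.
    rewrite mem_rem_uniq ?fset_uniq // => /andP[/andP[/negPf + _] _].
    by rewrite eq_sym => ->.
  rewrite big_seq_cond big1 // => A /andP[A_S _].
  by case: eqP nsub A_S => // -> /negP + A_S; rewrite -fpowersetE.
have := eqXY S; rewrite !split_count => /eqP.
rewrite [X in _ + X](_ : _ = \sum_(A <- enum_fset (fpowerset S) | A != S) count_mem A Y).
  by rewrite eqn_add2r => /eqP.
rewrite big_seq_cond [RHS]big_seq_cond; apply: eq_bigr => A /andP[A_S neq].
apply: IH; apply: leq_trans (_ : #|` S| <= m); last by [].
by rewrite fproper_ltn_card // fproperEneq neq -fpowersetE.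
Qed.

(* The set [Des] of a word whose inverse is [s]: [Des] compares the positions of
   consecutive values, [descents] compares consecutive values. *)
Definition descents (s : seq nat) : {fset nat} :=
  [fset i in iota 1 (size s).-1 | nth 0 s i < nth 0 s i.-1].

Lemma mem_descents s i :
  (i \in descents s) = [&& 0 < i, i < size s & nth 0 s i < nth 0 s i.-1].
Proof. by rewrite !inE /= mem_iota andbA; congr (_ && _); lia. Qed.

(** * Linear extensions under two labelings *)

Section LinearExtensions.

Variables (T : eqType) (cov : rel T) (B : seq T).
Hypothesis B_uniq : uniq B.

Definition linext (u : seq T) :=
  allrel (fun x y => cov x y ==> (index x u < index y u)) B B.

Definition linexts := [seq u <- permutations B | linext u].

Section Resort.

Variables (w : T -> nat) (S : {fset nat}).
Hypothesis w_inj : {in B &, injective w}.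

(* If [descents (map w u)] is contained in [S], then cutting [u] after the
   positions in [S] gives blocks along which [w] increases; [block k] is the
   number of the block containing the letter at position [k], counted from 0. *)
Definition block (k : nat) := count (fun i => i <= k) (enum_fset S).

Lemma block_homo : {homo block : k l / k <= l}.
Proof. by move=> k l le_kl; apply: sub_count => i /= /leq_trans; apply. Qed.

(** A descent at [k.+1] compares positions [k] and [k.+1], so a cut there raises the block number
    between these two positions. *)
Lemma block_lt k : (block k < block k.+1) = (k.+1 \in S).
Proof.
have -> : block k.+1 = block k + count_mem k.+1 (enum_fset S).
  rewrite /block -count_predUI [X in _ + X](_ : _ = 0) ?addn0.
    by apply: eq_count => i /=; rewrite -ltnS ltnS leq_eqVlt ltnS orbC.
  rewrite -(count_pred0 (enum_fset S)).
  by apply: eq_count => i /=; case: eqP => [->|]; rewrite ?ltnn ?andbF.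
by rewrite -[X in X < _]addn0 ltn_add2l -has_count has_pred1.
Qed.

Definition key (u : seq T) (x : T) := block (index x u).

(** Lexicographic in block number and label: for [f] the key of a word, sorting that word keeps
    every block in place and orders its letters by [w]. *)
Definition lexle (f : T -> nat) : rel T :=
  fun x y => (f x < f y) || (f x == f y) && (w x <= w y).

Lemma lexle_total f : total (lexle f).
Proof. by move=> x y; rewrite /lexle; lia. Qed.

Lemma lexle_trans f : transitive (lexle f).
Proof. by move=> x y z; rewrite /lexle; lia. Qed.

Lemma lexle_anti f : {in B &, antisymmetric (lexle f)}.
Proof. by move=> x y xB yB; rewrite /lexle => le_xy; apply: w_inj => //; lia. Qed.

Definition resort u := sort (lexle (key u)) u.

Lemma perm_resort u : perm_eq (resort u) u.
Proof. exact/permEl/perm_sort. Qed.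

Lemma map_key u : uniq u -> map (key u) u = map block (iota 0 (size u)).
Proof.
case: u => // x0 u0; set u := _ :: u0 => u_uniq.
rewrite -{2}[u](mkseq_nth x0) /mkseq -map_comp; apply/eq_in_map => i.
by rewrite mem_iota => /andP[_ lt_i]; rewrite /= /key index_uniq.
Qed.

(** The keys of [u], read along [resort u] and along [u], form two weakly increasing lists with the
    same content, hence equal; by [map_key] this list depends only on the length of the word. *)
Lemma key_resort u : uniq u -> {in u, key (resort u) =1 key u}.
Proof.
move=> u_uniq x x_u.
have r_uniq : uniq (resort u) by rewrite (perm_uniq (perm_resort u)).
have eq_key : map (key u) (resort u) = map (key u) u.
  apply: (sorted_eq leq_trans anti_leq).
  - rewrite sorted_map; apply: sub_sorted (sort_sorted (@lexle_total (key u)) u).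
    by move=> y z; rewrite /lexle /=; lia.
  - by rewrite map_key //; apply: homo_sorted (iota_sorted _ _); exact: block_homo.
  - exact/perm_map/perm_resort.
have x_r : x \in resort u by rewrite mem_sort.
have := map_key r_uniq; rewrite (perm_size (perm_resort u)) -map_key // -eq_key.
by move/eq_in_map; apply.
Qed.

(** Between neighbours separated by a cut, [lexle] holds whatever the labels; inside a block it says
    precisely that there is no descent. *)
Lemma descents_subset u :
  uniq u -> (descents (map w u) `<=` S) = sorted (lexle (key u)) u.
Proof.
case: u => [_|x0 u0]; first by apply/fsubsetP=> i; rewrite !inE.
move: (x0 :: u0) => {u0} u u_uniq.
have step i : i.+1 < size u ->
   lexle (key u) (nth x0 u i) (nth x0 u i.+1) = (i.+1 \in S) || (w (nth x0 u i) <= w (nth x0 u i.+1)).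
  move=> lt_i; rewrite /lexle /key !index_uniq ?(ltnW lt_i) // -block_lt.
  by have := block_homo (leqnSn i); rewrite leq_eqVlt => /orP[/eqP->|->] //; rewrite ltnn eqxx.
apply/fsubsetP/(sortedP x0) => [sub i lt_i | srt i].
  rewrite step //; case: leqP => [_|lt]; first by rewrite orbT.
  by rewrite sub // mem_descents size_map lt_i /= !(nth_map x0) ?(ltnW lt_i).
rewrite mem_descents size_map => /and3P[i_gt0 lt_i].
case: i i_gt0 lt_i => // i _ lt_i; rewrite !(nth_map x0) ?(ltnW lt_i) // => lt_w.
by have := srt i lt_i; rewrite step // leqNgt lt_w orbF.
Qed.

End Resort.

Lemma mem_linexts u : (u \in linexts) = perm_eq u B && linext u.
Proof. by rewrite mem_filter mem_permutations andbC. Qed.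

Section TwoLabelings.

Variables (w w' : T -> nat) (S : {fset nat}).
Hypotheses (w_inj : {in B &, injective w}) (w'_inj : {in B &, injective w'}).
Hypothesis eq_strict :
  {in B &, forall x y, cov x y -> (w x < w y) = (w' x < w' y)}.

Let good w0 := [seq u <- linexts | descents (map w0 u) `<=` S].

(* For a cover [x, y] inside one block, [w x < w y] by the choice of [u], hence
   [w' x < w' y] and re-sorting the block keeps [x] before [y]. *)
Lemma resort_linext u : u \in good w -> resort w' S u \in good w'.
Proof.
rewrite !mem_filter -!mem_filter -/(linexts) => /andP[].
rewrite !mem_linexts => des_u /andP[u_B lin_u].
have u_uniq : uniq u by rewrite (perm_uniq u_B).
have memu : u =i B := perm_mem u_B.
have r_B : perm_eq (resort w' S u) B by apply: perm_trans (perm_resort _ _ _) u_B.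
have r_uniq : uniq (resort w' S u) by rewrite (perm_uniq r_B).
have memr : resort w' S u =i B := perm_mem r_B.
have srt' : sorted (lexle w' (key S u)) (resort w' S u).
  exact/sort_sorted/lexle_total.
rewrite r_B /= descents_subset //; apply/andP; split.
  (* By [key_resort] the re-sorted word has the same keys, and for those it is sorted by
     construction. *)
  rewrite (@eq_in_sorted _ (mem u) _ (lexle w' (key S u))) //.
    by move=> x y xu yu; rewrite /lexle !key_resort.
  by apply/allP=> x; rewrite mem_sort.
apply/allrelP=> x y xB yB; apply/implyP=> cxy.
have /implyP/(_ cxy) lt_xy := allrelP lin_u x y xB yB.
rewrite ltnNge; apply/negP=> le_yx.
have le_lex : lexle w' (key S u) y x.
  apply: (sorted_leq_index (@lexle_trans _ _) _ srt'); rewrite ?memr //.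
  by move=> z; rewrite /lexle eqxx leqnn orbT.
have lex_xy : lexle w (key S u) x y.
  apply: (sorted_ltn_index (@lexle_trans _ _)) lt_xy; rewrite ?memu //.
  by rewrite -descents_subset.
have neq_xy : x != y by apply: contraTneq lt_xy => ->; rewrite ltnn.
have neq_w : w x != w y by apply: contra neq_xy => /eqP/w_inj->.
have := eq_strict xB yB cxy; move: le_lex lex_xy neq_w; rewrite /lexle.
have neq_w' : w' x != w' y by apply: contra neq_xy => /eqP/w'_inj->.
by lia.
Qed.

(** The image determines the keys, by [key_resort], and these determine the preimage: [u] and [v]
    are both sorted for the same antisymmetric order. *)
Lemma resort_inj : {in good w &, injective (resort w' S)}.
Proof.
move=> u v; rewrite !mem_filter -!mem_filter -/(linexts) !mem_linexts.
move=> /and3P[des_u u_B _] /and3P[des_v v_B _] eq_r.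
have u_uniq : uniq u by rewrite (perm_uniq u_B).
have v_uniq : uniq v by rewrite (perm_uniq v_B).
have uv : perm_eq u v by rewrite (perm_trans u_B) // perm_sym.
have eq_key : {in B &, lexle w (key S u) =2 lexle w (key S v)}.
  have eqk x : x \in B -> key S u x = key S v x.
    move=> xB; rewrite -(key_resort w' S u_uniq) ?(perm_mem u_B) // eq_r.
    by rewrite key_resort // (perm_mem v_B).
  by move=> x y xB yB; rewrite /lexle !eqk.
apply: (@sorted_eq_in _ (lexle w (key S u))) => //.
- by move=> x y z _ _ _; exact: lexle_trans.
- by move=> x y; rewrite !(perm_mem u_B); exact: lexle_anti.
- by rewrite -descents_subset.
rewrite (eq_in_sorted eq_key) -?descents_subset //.
by apply/allP=> x; rewrite (perm_mem v_B).
Qed.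

Lemma count_descents_leq :
  count (fun A => A `<=` S) [seq descents (map w u) | u <- linexts] <=
  count (fun A => A `<=` S) [seq descents (map w' u) | u <- linexts].
Proof.
rewrite !count_map -!size_filter -/(good w) -/(good w').
rewrite -(size_map (resort w' S)); apply: uniq_leq_size.
  by rewrite map_inj_in_uniq ?filter_uniq ?permutations_uniq //; exact: resort_inj.
by move=> _ /mapP[u u_good ->]; exact: resort_linext.
Qed.

End TwoLabelings.

Theorem perm_descents_linexts (w w' : T -> nat) :
  {in B &, injective w} -> {in B &, injective w'} ->
  {in B &, forall x y, cov x y -> (w x < w y) = (w' x < w' y)} ->
  perm_eq [seq descents (map w u) | u <- linexts]
          [seq descents (map w' u) | u <- linexts].
Proof.
move=> w_inj w'_inj eq_strict; apply: count_fsubset_perm => S.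
(* The hypotheses are symmetric in [w] and [w'], so the injection yields both inequalities. *)
apply/anti_leq/andP; split; apply: count_descents_leq => //.
by move=> x y xB yB cxy; rewrite eq_strict.
Qed.

End LinearExtensions.

(** * Positions in words *)

Lemma index_map_in (T1 T2 : eqType) (f : T1 -> T2) (s : seq T1) x :
  {in s &, injective f} -> x \in s -> index (f x) (map f s) = index x s.
Proof.
elim: s => //= y s IH f_inj x_s.
rewrite (inj_in_eq f_inj) ?mem_head //; case: (eqVneq y x) x_s => // neq x_s.
rewrite IH //; last by move: x_s; rewrite inE eq_sym (negPf neq).
by move=> z t zs ts; apply: f_inj; rewrite inE ?zs ?ts orbT.
Qed.

Lemma pairwise_flatten_map (I : eqType) (T : Type) (r : rel I) (R : rel T)
    (f : I -> seq T) (s : seq I) :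
  pairwise r s -> {in s, forall i, pairwise R (f i)} ->
  (forall i j, r i j -> allrel R (f i) (f j)) ->
  pairwise R (flatten (map f s)).
Proof.
move=> + + rR; elim: s => //= i s IH /andP[r_i r_s] R_s.
rewrite pairwise_cat R_s ?mem_head //= IH //; last first.
  by move=> j j_s; apply: R_s; rewrite inE j_s orbT.
rewrite andbT; elim: s r_i {r_s R_s IH} => [|j s IH] /=; first by rewrite allrel0r.
by case/andP=> r_ij /IH; rewrite allrel_catr rR.
Qed.

(** Turns comparisons of labels, which are positions in a reading order, into comparisons of
    coordinates. *)
Lemma pairwise_ltn_index (T : eqType) (R : rel T) (s : seq T) :
  pairwise R s -> (forall x y, R x y -> ~~ R y x) ->
  {in s &, forall x y, x != y -> (index x s < index y s) = R x y}.
Proof.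
move=> Rs R_asym x y xs ys neq.
have lt_R u v : u \in s -> v \in s -> index u s < index v s -> R u v.
  move=> us vs lt_uv; have := pairwiseP u Rs (index u s) (index v s).
  by rewrite !inE !index_mem !nth_index //; apply.
apply/idP/idP => [|Rxy]; first exact: lt_R.
case: ltngtP => // [/lt_R|/index_inj eq_xy].
  by move/(_ ys xs)/R_asym; rewrite Rxy.
by rewrite eq_xy ?eqxx in neq.
Qed.

(* The tableau whose boxes, listed by increasing entry, form the word [u]. *)
Definition fill (a : seq nat) (u : seq (nat * nat)) : seq (seq nat) :=
  [seq [seq (index (i, j) u).+1 | j <- iota 0 (nth 0 a i)] | i <- iota 0 (size a)].

(* The cover relations of the poset of boxes whose linear extensions are the
   SPITs. *)
Definition spit_cov (x y : nat * nat) : bool :=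
  (x.1 == y.1) && (y.2 == x.2.+1) || [&& x.2 == 1, y.2 == 0 & y.1 == x.1.+1].

(** * The two reading orders of the boxes *)

Definition row_order (a : seq nat) : seq (nat * nat) :=
  flatten [seq [seq (i, j) | j <- iota 0 (nth 0 a i)] | i <- rev (iota 0 (size a))].

Definition col_order (a : seq nat) : seq (nat * nat) :=
  flatten [seq [seq (i, j) | i <- iota 0 (size a) & j < nth 0 a i]
             | j <- iota 0 (\max_(r <- a) r)].

Lemma mem_boxes a x : (x \in boxes a) = (x.1 < size a) && (x.2 < nth 0 a x.1).
Proof.
case: x => i j; apply/allpairsPdep/andP => [[i' [j']] | [/= lt_i lt_j]].
  by rewrite !mem_iota => -[/andP[_ lt_i] /andP[_ lt_j] [-> ->]].
by exists i, j; rewrite !mem_iota.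
Qed.

Lemma boxes_uniq a : uniq (boxes a).
Proof.
apply: allpairs_uniq_dep => [|i _|]; rewrite ?iota_uniq //.
by move=> [i j] [i' j'] _ _ /= [-> ->].
Qed.

Lemma size_boxes a : size (boxes a) = sumn a.
Proof.
rewrite size_allpairs_dep; congr sumn; rewrite -[RHS](mkseq_nth 0).
by apply: eq_map => i; rewrite size_iota.
Qed.

Definition row_lt : rel (nat * nat) :=
  fun x y => (y.1 < x.1) || (x.1 == y.1) && (x.2 < y.2).

Definition col_lt : rel (nat * nat) :=
  fun x y => (x.2 < y.2) || (x.2 == y.2) && (x.1 < y.1).

Lemma row_lt_asym x y : row_lt x y -> ~~ row_lt y x.
Proof. by rewrite /row_lt; lia. Qed.

Lemma col_lt_asym x y : col_lt x y -> ~~ col_lt y x.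
Proof. by rewrite /col_lt; lia. Qed.

Lemma pairwise_row_order a : pairwise row_lt (row_order a).
Proof.
rewrite /row_lt.
apply: (@pairwise_flatten_map _ _ (fun i i' => i' < i)).
- rewrite -sorted_pairwise; first by rewrite rev_sorted iota_ltn_sorted.
  by move=> i j k; lia.
- move=> i _; rewrite pairwise_map; apply: sub_pairwise (_ : pairwise ltn _).
    by move=> j j' /= ->; rewrite eqxx orbT.
  by rewrite -sorted_pairwise ?iota_ltn_sorted //; exact: ltn_trans.
move=> i i' lt_i; apply/allrelP => _ _ /mapP[j _ ->] /mapP[j' _ ->].
by rewrite /= lt_i.
Qed.

Lemma pairwise_col_order a : pairwise col_lt (col_order a).
Proof.
rewrite /col_lt.
apply: (@pairwise_flatten_map _ _ ltn).
- by rewrite -sorted_pairwise ?iota_ltn_sorted //; exact: ltn_trans.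
- move=> j _; rewrite pairwise_map; apply: sub_pairwise (_ : pairwise ltn _).
    by move=> i i' /= ->; rewrite eqxx orbT.
  rewrite pairwise_filter // -sorted_pairwise ?iota_ltn_sorted //; exact: ltn_trans.
move=> j j' lt_j; apply/allrelP => _ _ /mapP[i _ ->] /mapP[i' _ ->].
by apply/orP; left.
Qed.

Lemma perm_row_order a : perm_eq (row_order a) (boxes a).
Proof. by apply/perm_flatten/perm_map; rewrite perm_rev. Qed.

Lemma perm_col_order a : perm_eq (col_order a) (boxes a).
Proof.
apply: uniq_perm; rewrite ?boxes_uniq //.
  by apply: pairwise_uniq (pairwise_col_order a) => x; rewrite /col_lt !ltnn andbF.
move=> [i j]; rewrite mem_boxes /=; apply/flatten_mapP/andP => [[j' _ /mapP[i']]|].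
  by rewrite mem_filter mem_iota => /and3P[lt_j _ lt_i] [-> ->].
move=> [lt_i lt_j]; exists j; last by apply: map_f; rewrite mem_filter lt_j mem_iota.
rewrite mem_iota /= add0n (leq_trans lt_j) //.
by apply: leq_bigmax_seq => //; rewrite mem_nth.
Qed.

(** * Fillings as words of boxes *)

Lemma shape_fill a u : shape (fill a u) = a.
Proof.
rewrite /shape -map_comp -[RHS](mkseq_nth 0).
by apply: eq_map => i; rewrite /= size_map size_iota.
Qed.

Lemma flatten_fill a u : flatten (fill a u) = [seq (index x u).+1 | x <- boxes a].
Proof. by rewrite map_flatten -map_comp; congr flatten; apply: eq_map => i; rewrite /= -map_comp. Qed.

Lemma entry_fill a u x : x \in boxes a -> entry (fill a u) x = (index x u).+1.
Proof.
rewrite mem_boxes /entry => /andP[lt_i lt_j]; rewrite (nth_map 0) ?size_iota //.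
by rewrite (nth_map 0) ?size_iota // !nth_iota //; case: x lt_i lt_j.
Qed.

Lemma wr_fill a u : wr (fill a u) = [seq (index x u).+1 | x <- row_order a].
Proof.
rewrite map_flatten -map_comp /wr -map_rev; congr flatten.
by apply: eq_map => i; rewrite /= -map_comp.
Qed.

Lemma wc_fill a u : wc (fill a u) = [seq (index x u).+1 | x <- col_order a].
Proof.
rewrite map_flatten -map_comp /wc.
have -> : \max_(r <- fill a u) size r = \max_(r <- a) r.
  by rewrite -(big_map size xpredT id) -/(shape _) shape_fill.
congr flatten; apply: eq_map => j; rewrite /= -map_comp /fill filter_map -map_comp.
have eq_f : [pred i | j < size [seq (index (i, j0) u).+1 | j0 <- iota 0 (nth 0 a i)]] =1
   (fun i => j < nth 0 a i) by move=> i /=; rewrite size_map size_iota.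
rewrite (eq_filter eq_f); apply/eq_in_map => i; rewrite mem_filter => /andP[lt_j _] /=.
by rewrite (nth_map 0) ?size_iota // nth_iota.
Qed.

Lemma map_index_uniq (T : eqType) (u : seq T) : uniq u -> map (index^~ u) u = iota 0 (size u).
Proof.
case: u => // x0 u0; move: (x0 :: u0) => {u0} u u_uniq.
rewrite -{2}[u](mkseq_nth x0) /mkseq -map_comp -[RHS]map_id; apply/eq_in_map => i.
by rewrite mem_iota => /andP[_ lt_i]; rewrite /= index_uniq.
Qed.

(** The entry [k.+1] sits in the box at position [k] of [u], so its place in the reading is the
    label of that box: the labels along [u] spell the inverse of the reading word. *)
Lemma Des_reading a u s : perm_eq u (boxes a) -> perm_eq s (boxes a) ->
  Des [seq (index x u).+1 | x <- s] = descents (map (index^~ s) u).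
Proof.
move=> u_B s_B; have su : perm_eq s u by rewrite (perm_trans s_B) // perm_sym.
have u_uniq : uniq u by rewrite (perm_uniq u_B) boxes_uniq.
apply/fsetP=> i; rewrite mem_descents !inE /= mem_iota !size_map (perm_size su).
case: i => [|i] //=.
have -> : (i.+1 < 1 + (size u).-1) = (i.+1 < size u) by lia.
case: (boolP (i.+1 < size u)) => //= lt_i.
have x0 : nat * nat by exact: (0, 0).
have idx k : k < size u ->
    index k.+1 [seq (index x u).+1 | x <- s] = nth 0 (map (index^~ s) u) k.
  move=> lt_k; rewrite (nth_map x0) // -{1}(index_uniq x0 lt_k u_uniq).
  rewrite (@index_map_in _ _ (fun x => (index x u).+1)) ?(perm_mem su) ?mem_nth //.
  by move=> x y xs ys [/index_inj]; rewrite -!(perm_mem su) => ->.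
by rewrite !idx // ltnW.
Qed.

(** Both lists are duplicate-free and have [(sumn a)!] members, so one inclusion is enough. *)
Lemma perm_fill a : perm_eq [seq fill a u | u <- permutations (boxes a)] (fillings a).
Proof.
have fill_inj : {in permutations (boxes a) &, injective (fill a)}.
  move=> u v; rewrite !mem_permutations => u_B v_B /(congr1 flatten).
  rewrite !flatten_fill => /eq_in_map eq_idx.
  have u_uniq : uniq u by rewrite (perm_uniq u_B) boxes_uniq.
  have sz : size u = size v by rewrite (perm_size u_B) (perm_size v_B).
  apply: (@eq_from_nth _ (0, 0)) => // k lt_k; set x := nth _ u k.
  have xB : x \in boxes a by rewrite -(perm_mem u_B) mem_nth.
  have [] := eq_idx x xB; rewrite index_uniq // => ->.
  by rewrite nth_index // (perm_mem v_B).
have U : uniq [seq fill a u | u <- permutations (boxes a)].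
  by rewrite map_inj_in_uniq ?permutations_uniq.
apply: uniq_perm; rewrite ?fillings_uniq //.
suff [] : (size [seq fill a u | u <- permutations (boxes a)] = size (fillings a)) *
  ([seq fill a u | u <- permutations (boxes a)] =i fillings a) by [].
apply: (uniq_min_size U) => [T /mapP[u]|]; last first.
  by rewrite !size_map !size_permutations ?boxes_uniq ?iota_uniq // size_iota size_boxes.
rewrite mem_permutations => u_B ->; rewrite mem_fillings shape_fill eqxx /=.
have u_uniq : uniq u by rewrite (perm_uniq u_B) boxes_uniq.
rewrite flatten_fill -size_boxes -(perm_size u_B) -[iota 1 _]/(iota (1 + 0) _) iotaDl.
rewrite -map_index_uniq // -map_comp; apply: perm_map; rewrite perm_sym; exact: u_B.
Qed.

(** * The peak condition as a system of covers *)

(** A downward closed [p] holds on an initial segment, whose length is the count. This measures both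
    the filled part of a row and the number of rows started. *)
Lemma ltn_count_iota (p : pred nat) n j :
  (forall i, i.+1 < n -> p i.+1 -> p i) ->
  (j < count p (iota 0 n)) = (j < n) && p j.
Proof.
elim: n p j => //= n IH p j p_down; rewrite -[iota 1 n]/(iota (1 + 0) n) iotaDl count_map.
have IHj i := IH (p \o succn) i (fun l lt_l => p_down l.+1 lt_l).
case: (boolP (p 0)) => [p0|np0]; first by case: j => [|j]; rewrite ?p0 // add1n ltnS IHj.
have np i : i < n.+1 -> ~~ p i.
  by elim: i => // i IHi lt_i; apply: contra (IHi (ltnW lt_i)); exact: p_down.
case: (ltnP j n.+1) => [/np/negPf->|le_j] /=.
  rewrite add0n; case: count (IHj 0) => // l /esym/andP[n_gt0 /= p1].
  by rewrite (negPf (np 1 _)) in p1.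
by apply/negbTE; rewrite -leqNgt (leq_trans (count_size _ _)) // size_iota ltnW.
Qed.

Lemma peak_compP a :
  reflect ((forall i, i < size a -> 0 < nth 0 a i) /\
           (forall i, i.+1 < size a -> 1 < nth 0 a i)) (peak_comp a).
Proof.
have lt_pred i : (i < (size a).-1) = (i.+1 < size a) by lia.
have sz : size (take (size a).-1 a) = (size a).-1 by rewrite size_takel ?leq_pred.
apply: (iffP andP) => [[/(all_nthP 0) pos /(all_nthP 0) gt1]|[pos gt1]].
  by split=> // i lt_i; have := gt1 i; rewrite sz lt_pred nth_take ?lt_pred //; apply.
split; apply/(all_nthP 0) => // i; rewrite sz lt_pred => lt_i.
by rewrite nth_take ?lt_pred //; apply: gt1.
Qed.

(** The peak condition on [a] guarantees that the boxes [(i, 1)] and [(i.+1, 0)] of the second kind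
    of cover exist. *)
Lemma linext_spit_covP a u : peak_comp a ->
  reflect ((forall i j, i < size a -> j.+1 < nth 0 a i -> index (i, j) u < index (i, j.+1) u) /\
           (forall i, i.+1 < size a -> index (i, 1) u < index (i.+1, 0) u))
          (linext spit_cov (boxes a) u).
Proof.
move=> /peak_compP[pos gt1]; apply: (iffP allrelP) => [lin|[rows spine]].
  split=> [i j lt_i lt_j | i lt_i].
    have := lin (i, j) (i, j.+1).
    by rewrite !mem_boxes /= lt_i lt_j (ltnW lt_j) /spit_cov /= !eqxx; apply.
  have := lin (i, 1) (i.+1, 0).
  by rewrite !mem_boxes /= lt_i (ltnW lt_i) gt1 // pos // /spit_cov /= eqxx orbT; apply.
move=> [i j] [i' j']; rewrite !mem_boxes /= => /andP[lt_i _] /andP[lt_i' lt_j'].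
apply/implyP; rewrite /spit_cov /=.
by case/orP=> [/andP[/eqP ii /eqP jj]|/and3P[/eqP jj /eqP jj' /eqP ii]]; subst; auto.
Qed.

Lemma boxes_le_fill a u k b : perm_eq u (boxes a) ->
  reflect (forall x, (x \in boxes b) = (x \in boxes a) && (index x u < k))
          (boxes_le k (fill a u) == diagram b).
Proof.
move=> u_B; have mem_le x : (x \in boxes_le k (fill a u)) = (x \in boxes a) && (index x u < k).
  rewrite !inE shape_fill; case: (boolP (x \in _)) => //= x_a.
  by rewrite entry_fill.
apply: (iffP eqP) => [eq_b x | eq_b]; first by rewrite -mem_le eq_b inE.
by apply/fsetP=> x; rewrite mem_le inE eq_b.
Qed.

Lemma SIT_fill a u : peak_comp a -> perm_eq u (boxes a) ->
  reflect ((forall i j, i < size a -> j.+1 < nth 0 a i -> index (i, j) u < index (i, j.+1) u) /\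
           (forall i, i.+1 < size a -> index (i, 0) u < index (i.+1, 0) u))
          (fill a u \in SIT a).
Proof.
move=> /peak_compP[pos gt1] u_B.
rewrite mem_filter -(perm_mem (perm_fill a)) map_f ?mem_permutations // andbT.
(* Rows are non-empty, so [head] never returns its default. *)
have hd : [seq head 0 r | r <- fill a u] = [seq (index (i, 0) u).+1 | i <- iota 0 (size a)].
  rewrite -map_comp; apply/eq_in_map => i; rewrite mem_iota => /andP[_ lt_i] /=.
  by case: (nth 0 a i) (pos i lt_i).
rewrite hd; apply: (iffP andP) => [[/allP rows /(sortedP 0) col]|[rows col]]; split.
- move=> i j lt_i lt_j; have /rows/(sortedP 0)/(_ j) :
    [seq (index (i, j) u).+1 | j <- iota 0 (nth 0 a i)] \in fill a u.
    by apply: map_f; rewrite mem_iota.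
  rewrite size_map size_iota !(nth_map 0) ?size_iota ?(ltnW lt_j) // !nth_iota ?(ltnW lt_j) //.
  by apply.
- move=> i lt_i; have := col i.
  rewrite size_map size_iota !(nth_map 0) ?size_iota ?(ltnW lt_i) // !nth_iota ?(ltnW lt_i) //.
  by apply.
- apply/allP=> _ /mapP[i + ->]; rewrite mem_iota => /andP[_ lt_i].
  apply/(sortedP 0) => j; rewrite size_map size_iota => lt_j.
  rewrite !(nth_map 0) ?size_iota ?(ltnW lt_j) // !nth_iota ?(ltnW lt_j) //.
  exact: rows.
apply/(sortedP 0) => i; rewrite size_map size_iota => lt_i.
rewrite !(nth_map 0) ?size_iota ?(ltnW lt_i) // !nth_iota ?(ltnW lt_i) //.
exact: col.
Qed.

(** Compared with [SIT_fill], the box that must precede [(i.+1, 0)] moves from [(i, 0)] to [(i, 1)]: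
    this is what the peak condition on all initial fillings adds. *)
Lemma SPIT_linext a u : peak_comp a -> perm_eq u (boxes a) ->
  (fill a u \in SPIT a) = linext spit_cov (boxes a) u.
Proof.
move=> a_peak u_B; have /peak_compP[pos gt1] := a_peak.
have memu : u =i boxes a := perm_mem u_B.
have box1 i : i.+1 < size a -> (i, 1) \in boxes a.
  by move=> lt_i; rewrite mem_boxes /= ltnW ?gt1.
have box0 i : i < size a -> (i, 0) \in boxes a.
  by move=> lt_i; rewrite mem_boxes /= lt_i pos.
have size_u : size u = sumn a by rewrite (perm_size u_B) size_boxes.
rewrite mem_filter; apply/andP/linext_spit_covP => //; last first.
  move=> [rows spine]; split; last first.
    apply/SIT_fill => //; split=> // i lt_i; apply: leq_trans (spine i lt_i).
    by apply: ltnW; apply: rows; rewrite ?gt1 ?(ltnW lt_i).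
  apply/allP=> k; rewrite mem_iota => /andP[k_gt0 le_k]; rewrite add1n ltnS in le_k.
  (* The witness: [c i] boxes of row [i] have entries at most [k], and [m] rows have been
     started. *)
  pose c i := count (fun j => index (i, j) u < k) (iota 0 (nth 0 a i)).
  have cP i j : i < size a -> (j < c i) = (j < nth 0 a i) && (index (i, j) u < k).
    move=> lt_i; apply: ltn_count_iota => l lt_l; exact/ltn_trans/rows.
  pose m := count (fun i => 0 < c i) (iota 0 (size a)).
  have m_le : m <= size a by rewrite /m -[X in _ <= X](size_iota 0) count_size.
  have cm i : i < size a -> (0 < c i) = (i < m).
    move=> lt_i; rewrite [RHS]ltn_count_iota ?lt_i // => l lt_l.
    rewrite !cP ?(ltnW lt_l) // !pos ?(ltnW lt_l) //=.
    (* Rows start in order: [(l, 0)] precedes [(l, 1)], which precedes [(l.+1, 0)]. *)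
    by apply: ltn_trans; apply: ltn_trans (spine l lt_l); rewrite rows ?gt1 ?(ltnW lt_l).
  pose b := mkseq c m.
  have bP x : (x \in boxes b) = (x \in boxes a) && (index x u < k).
    case: x => i j; rewrite !mem_boxes /= size_mkseq.
    case: (ltnP i (size a)) => [lt_i|le_i]; last by rewrite ltnNge (leq_trans m_le).
    rewrite -cP // -cm //.
    have [c_gt0|] := posnP (c i); first by rewrite c_gt0.
    by move=> c_gt0; rewrite nth_mkseq // -cm.
  apply/hasP; exists b; last first.
    rewrite (introT (boxes_le_fill _ _ u_B)) // andbT; apply/peak_compP.
    rewrite size_mkseq; split=> i lt_i.
      by rewrite nth_mkseq // cm // (leq_trans lt_i).
    have lt_i' := leq_trans lt_i m_le.
    (* Row [i.+1] is started, so [(i, 1)] is already filled and row [i] has at least two boxes. *)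
    rewrite nth_mkseq ?(ltnW lt_i) // cP ?gt1 ?(ltnW lt_i') //=; apply: ltn_trans (spine i lt_i') _.
    by have := cm _ lt_i'; rewrite lt_i cP // pos.
  rewrite mem_comps; apply/andP; split.
    apply/(all_nthP 0) => i; rewrite size_mkseq => lt_i.
    by rewrite nth_mkseq // cm // (leq_trans lt_i).
  (* The boxes of [b] are the first [k] letters of [u], so the parts of [b] sum to [k]. *)
  rewrite -size_boxes -(size_takel (n0 := k) (s := u)) ?size_u //.
  apply/eqP/perm_size/uniq_perm; rewrite ?boxes_uniq ?take_uniq ?(perm_uniq u_B) ?boxes_uniq //.
  move=> x; rewrite bP -memu; apply/andP/idP => [[xu lt_x]|x_k]; first by rewrite in_take.
  by have xu := mem_take x_k; rewrite -in_take.
move=> [/allP spit /(SIT_fill a_peak u_B)[rows col]]; split=> // i lt_i.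
have x0 := box0 _ lt_i; have x1 := box1 _ lt_i.
(* Stop at the entry of [(i.+1, 0)]: row [i] is then not the last row of [b], so it has at least two
   boxes. *)
pose k := (index (i.+1, 0) u).+1.
have /spit/hasP[b _ /andP[/peak_compP[_ b_gt1] /(boxes_le_fill _ _ u_B) bP]] : k \in iota 1 (sumn a).
  by rewrite mem_iota /= add1n ltnS -size_u index_mem memu.
have := bP (i.+1, 0); rewrite x0 leqnn mem_boxes /= => /andP[lt_b _].
have := bP (i, 1); rewrite mem_boxes /= ltnW // b_gt1 // => /esym/andP[_].
rewrite ltnS leq_eqVlt => /predU1P[eq_idx|//].
by have/index_inj := eq_idx; rewrite !memu => /(_ (0, 0) x1 x0)[].
Qed.

(** * Comparison of the two readings *)

Lemma perm_SPIT a :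
  peak_comp a -> perm_eq (SPIT a) (map (fill a) (linexts spit_cov (boxes a))).
Proof.
move=> a_peak; have fill_uniq : uniq (map (fill a) (permutations (boxes a))).
  by rewrite (perm_uniq (perm_fill a)) fillings_uniq.
apply: uniq_perm => [||T].
- by rewrite !filter_uniq ?fillings_uniq.
- exact: subseq_uniq (map_subseq _ (filter_subseq _ _)) fill_uniq.
apply/idP/mapP => [T_spit | [u]].
  have : T \in fillings a by move: T_spit; rewrite !mem_filter => /and3P[].
  rewrite -(perm_mem (perm_fill a)) => /mapP[u u_B T_u]; exists u => //.
  by rewrite mem_filter u_B -SPIT_linext -?T_u ?T_spit // -mem_permutations.
by rewrite mem_linexts => /andP[u_B lin_u] ->; rewrite SPIT_linext.
Qed.

Lemma perm_Des_reading a (rd : seq (seq nat) -> seq nat) s :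
  peak_comp a -> perm_eq s (boxes a) ->
  (forall u, rd (fill a u) = [seq (index x u).+1 | x <- s]) ->
  perm_eq [seq Des (rd T) | T <- SPIT a]
          [seq descents (map (index^~ s) u) | u <- linexts spit_cov (boxes a)].
Proof.
move=> a_peak s_B rdE; apply: perm_trans (perm_map _ (perm_SPIT a_peak)) _.
rewrite -map_comp; apply/permPl.
suff -> : [seq descents (map (index^~ s) u) | u <- linexts spit_cov (boxes a)]
  = map ((fun T => Des (rd T)) \o fill a) (linexts spit_cov (boxes a)) by [].
apply/esym/eq_in_map => u; rewrite mem_linexts => /andP[u_B _] /=.
by rewrite rdE; apply: Des_reading u_B s_B.
Qed.

Lemma perm_Des_wc_wr a : peak_comp a ->
  perm_eq [seq Des (wc T) | T <- SPIT a] [seq Des (wr T) | T <- SPIT a].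
Proof.
move=> a_peak; have col_B := perm_col_order a; have row_B := perm_row_order a.
apply: perm_trans (perm_Des_reading a_peak col_B (@wc_fill a)) _; rewrite perm_sym.
apply: perm_trans (perm_Des_reading a_peak row_B (@wr_fill a)) _.
apply: perm_descents_linexts; rewrite ?boxes_uniq //.
- by move=> x y; rewrite -!(perm_mem row_B) => xs ys; apply: index_inj.
- by move=> x y; rewrite -!(perm_mem col_B) => xs ys; apply: index_inj.
move=> x y xB yB cov_xy.
have neq : x != y by apply: contraTneq cov_xy => ->; rewrite /spit_cov; lia.
rewrite (pairwise_ltn_index (pairwise_row_order a) row_lt_asym) ?(perm_mem row_B) //.
rewrite (pairwise_ltn_index (pairwise_col_order a) col_lt_asym) ?(perm_mem col_B) //.
(* Along a row both readings move forward; from [(i, 1)] to [(i.+1, 0)] both move backward, one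
   because upper rows come first, the other because column 0 does. *)
by move: cov_xy; rewrite /spit_cov /row_lt /col_lt; lia.
Qed.

Local Open Scope ring_scope.

Theorem corollary3p15 (alpha : seq nat) (halpha : peak_comp alpha) :
  perm_eq [seq Des (wc T) | T <- SPIT alpha] [seq Des (wr T) | T <- SPIT alpha]
  /\ Qtilde alpha =
     \sum_(T <- SPIT alpha) K (comp_of_set (sumn alpha) (Peak (Des (wr T)))).
Proof.
have perm_Des := perm_Des_wc_wr halpha; split=> //; rewrite /Qtilde.
(* Each summand depends on [T] only through its descent set, so (a) gives (b). *)
pose K_of D := K (comp_of_set (sumn alpha) (Peak D)).
rewrite -[LHS](big_map (fun T => Des (wc T)) xpredT K_of).
by rewrite (perm_big _ perm_Des) big_map.
Qed.
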